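(* Let $k\ge 3$ and let $\sigma=\sigma_1\sigma_2\cdots\sigma_k\text{-}\sigma_{k+1}$ be a quasi-consecutive vincular pattern (with $\sigma_1\cdots\sigma_{k+1}\in S_{k+1}$) such that $\sigma_{k+1}=\sigma_i+1$ for some $2\le i\le k-1$. Let $$\tau=\sigma_1\cdots\sigma_{i-1}\,\sigma_{k+1}\,\sigma_{i+1}\cdots\sigma_k\text{-}\sigma_i$$ be the pattern obtained by interchanging $\sigma_i$ and $\sigma_{k+1}$. Suppose that $$\sigma_1\cdots\sigma_z\not\sim\sigma_{k-z+1}\cdots\sigma_k$$ for all integers $z$ with $\min(i,k-i+1)\le z<k$. Then $\sigma\equiv\tau$, i.e. $\sigma$ and $\tau$ are Wilf-equivalent.
   Context: $S_n$ is the set of permutations of $\{1,\dots,n\}$ in one-line notation. Two sequences of positive integers of the same length are order-isomorphic, $a_1\cdots a_m\sim b_1\cdots b_m$, if for all $p,q$ one has $a_p<a_q$ iff $b_p<b_q$. A permutation $\pi\in S_n$ contains the quasi-consecutive pattern $\sigma_1\cdots\sigma_k\text{-}\sigma_{k+1}$ if there are indices $1\le i_1<\cdots<i_{k+1}\le n$ with $i_{p+1}=i_p+1$ for $1\le p\le k-1$ and $\pi_{i_1}\cdots\pi_{i_{k+1}}\sim\sigma_1\cdots\sigma_{k+1}$; otherwise it avoids it. $S_n(\sigma)$ is the set of permutations in $S_n$ avoiding $\sigma$. Patterns $\sigma,\tau$ are Wilf-equivalent, $\sigma\equiv\tau$, if $|S_n(\sigma)|=|S_n(\tau)|$ for every positive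 integer $n$. *)

(* Defs.v *)
From mathcomp Require Import all_boot all_fingroup.

Set Implicit Arguments.
Unset Strict Implicit.
Unset Printing Implicit Defensive.

Definition order_iso (a b : seq nat) : bool :=
  (size a == size b) &&
  [forall p : 'I_(size a), forall q : 'I_(size a),
     (nth 0 a p < nth 0 a q) == (nth 0 b p < nth 0 b q)].

(* 'S_n permutes {0, ..., n-1}; values are shifted by one so that the word
   uses the letters 1, ..., n. Positions in the word remain 0-based. *)
Definition one_line n (s : 'S_n) : seq nat :=
  [seq (val (s j)).+1 | j <- enum 'I_n].

(* The permutation [sigma : 'S_k.+1] stands for the vincular pattern
   sigma_1 ... sigma_k - sigma_(k+1). The map [f] lists the positions
   i_1 < ... < i_(k+1) (0-based), the first [k] of which are consecutive. *)
Definition qc_occurrence k n (sigma : 'S_k.+1) (pi : 'S_n)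
    (f : {ffun 'I_k.+1 -> 'I_n}) : bool :=
  [&& [forall p : 'I_k.+1, forall q : 'I_k.+1, (p < q) ==> (f p < f q)],
      [forall p : 'I_k.+1, forall q : 'I_k.+1,
         (val q == p.+1) && (q < k) ==> (val (f q) == (f p).+1)]
    & order_iso [seq (val (pi (f p))).+1 | p <- enum 'I_k.+1]
                (one_line sigma)].

Definition qc_contains k n (sigma : 'S_k.+1) (pi : 'S_n) : bool :=
  [exists f : {ffun 'I_k.+1 -> 'I_n}, qc_occurrence sigma pi f].

Definition qc_avoiders n k (sigma : 'S_k.+1) : {set 'S_n} :=
  [set pi : 'S_n | ~~ qc_contains sigma pi].

Definition wilf_equiv k l (sigma : 'S_k.+1) (tau : 'S_l.+1) : Prop :=
  forall n : nat, 0 < n -> #|qc_avoiders n sigma| = #|qc_avoiders n tau|.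

(* The 1-based position [i], for 1 <= i <= k.+1. *)
Definition pos k (i : nat) : 'I_k.+1 := inord i.-1.

(* Products of permutations compose left to right, so this is
   [j |-> s (tperm a b j)]: the letters at positions [a] and [b] of the
   one-line notation are interchanged, not the values [a] and [b]. *)
Definition swap_letters n (a b : 'I_n) (s : 'S_n) : 'S_n :=
  (tperm a b * s)%g.

(* The factor w_a w_(a+1) ... w_b, with 1-based positions. *)
Definition factor (w : seq nat) (a b : nat) : seq nat := drop a.-1 (take b w).

(* Main.v *)
(** Both patterns have the same first [k] letters, so they share their windows
    (occurrences of those letters) and differ only in the last letter: with
    [x] the letter at the distinguished position [i] of a window, [sigma]
    needs a later letter just above [x] and [tau] one just below [x], "just"
    meaning that no other letter of the window lies in between. Let [S] consist
    of [x] and of the later letters in the same gap of the window. The window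
    extends to no occurrence of [sigma] iff [x] is the maximum of [S], and to
    none of [tau] iff [x] is its minimum. Rotating the values in [S] cyclically
    by one step exchanges these two conditions; when [x] is the maximum, it
    keeps the relative order of all letters to the right of [x] and the set of
    values found there together with [x]. The overlap hypothesis says that the
    position of [x] lies in no other window, so the rotation creates or
    destroys no window and does not alter the status of the others. Rotating
    at the possible windows one after the other turns [sigma]-avoiders into
    [tau]-avoiders bijectively. *)

Require Import Defs.
From mathcomp Require Import all_boot all_fingroup.
From mathcomp Require Import zify.

Set Implicit Arguments.
Unset Strict Implicit.
Unset Printing Implicit Defensive.

(** * Cyclic rotation along the increasing enumeration of a set of values *)

Definition rot_values n (S : {set 'I_n}) : 'S_n :=
  perm (can_inj (prev_next (enum_uniq S))).

Lemma mem_rot_values n (S : {set 'I_n}) v : (rot_values S v \in S) = (v \in S).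
Proof. by rewrite permE -mem_enum mem_next mem_enum. Qed.

Lemma rot_values_out n (S : {set 'I_n}) v : v \notin S -> rot_values S v = v.
Proof. by rewrite permE next_nth mem_enum => /negbTE ->. Qed.

Lemma sorted_enum_ord n (S : {set 'I_n}) :
  sorted (fun u v : 'I_n => u < v) (enum S).
Proof.
have tr : transitive (fun u v : 'I_n => u < v) by move=> ? ? ?; apply: ltn_trans.
rewrite /enum_mem -enumT (sorted_filter tr) //.
have := iota_ltn_sorted 0 n.
by rewrite -val_enum_ord sorted_map.
Qed.

(** In the increasing enumeration [m] comes last, so it wraps around to the first entry. All other
    indices move up by one, which preserves order. *)
Lemma rot_values_max n (S : {set 'I_n}) (m : 'I_n) :
    m \in S -> {in S, forall v : 'I_n, v <= m} ->
  {in S, forall v : 'I_n, rot_values S m <= v} /\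
  {in S :\ m &, forall u v : 'I_n, (rot_values S u < rot_values S v) = (u < v)}.
Proof.
move=> mS maxm; pose e := enum S.
have es : sorted (fun u v : 'I_n => u < v) e := sorted_enum_ord S.
have tr : transitive (fun u v : 'I_n => u < v) by move=> ? ? ?; apply: ltn_trans.
have lt_nth i j : i < j < size e -> nth m e i < nth m e j.
  move=> /andP[ij js]; apply: (sorted_ltn_nth tr m es) => //.
  by rewrite inE (ltn_trans ij).
have lt_nthE i j : i < size e -> j < size e -> (nth m e i < nth m e j) = (i < j).
  move=> si sj; case: (ltngtP i j) => [ij|ji|->].
  - by rewrite lt_nth ?ij.
  - by apply/negbTE; rewrite -leqNgt ltnW // lt_nth ?ji.
  - by rewrite ltnn.
have idx v : v \in S -> (index v e < size e) * (nth m e (index v e) = v).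
  by rewrite -mem_enum => ve; rewrite index_mem ve nth_index.
have im : (index m e).+1 = size e.
  have [lt_m nth_m] := idx m mS.
  case: (ltngtP (index m e).+1 (size e)) => // [lt|]; last by rewrite ltnS leqNgt lt_m.
  have := maxm (nth m e (index m e).+1).
  rewrite -mem_enum mem_nth // => /(_ isT).
  have := lt_nth (index m e) (index m e).+1.
  by rewrite nth_m leqnn lt => /(_ isT); rewrite ltnNge => /negbTE ->.
have idxS v : v \in S -> v != m -> (index v e).+1 < size e.
  move=> vS nvm; have [lt_v nth_v] := idx v vS.
  rewrite -im ltnS ltn_neqAle -ltnS im lt_v andbT.
  by apply: contraNneq nvm => eq_i; rewrite -nth_v eq_i (idx m mS).2.
have rotE v : v \in S ->
    rot_values S v = nth m e (if v == m then 0 else (index v e).+1).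
  move=> vS; rewrite permE next_nth mem_enum vS -/e.
  case: eqP => [->|/eqP nvm].
    (* [next] reads the tail of [e] with the head as default value. The index of [m] is just past
       the end of the tail, so the head is returned. *)
    case: (e) im => [//|y e'] [im] /=.
    by rewrite nth_default // im.
  have := idxS v vS nvm.
  case: (e) => [//|y e'] lt' /=.
  exact: set_nth_default.
split=> [v vS|u v /setD1P[num uS] /setD1P[nvm vS]].
  rewrite rotE // eqxx -(idx v vS).2 leqNgt lt_nthE ?(idx v vS).1 //.
  by rewrite -im.
rewrite !rotE // (negbTE num) (negbTE nvm) lt_nthE ?idxS // ltnS.
by rewrite -lt_nthE ?(idx _ _).1 // !(idx _ _).2.
Qed.

(** * Windows, their completions, and the gap around the key letter *)

Section Windows.

Variables (n k : nat) (s : nat -> nat) (key : nat).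
Implicit Types (w : 'S_n.+1) (a b j p q : nat) (g : nat -> bool).

(** Positions are plain numbers, to allow arithmetic such as [a + p]; one out of range is read as
    position 0, hence the bounds carried along below. *)
Definition letter w j : nat := w (inord j).

Definition window w a : bool :=
  (a + k <= n.+1) &&
  [forall p : 'I_k, forall q : 'I_k,
     (letter w (a + p) < letter w (a + q)) == (s p < s q)].

(** Letters are distinct, so [g], marking the window letters below the later letter, fixes its
    relative order completely. *)
Definition completed g w a : bool :=
  [exists j : 'I_n.+1, (a + k <= j) &&
     [forall p : 'I_k, (letter w (a + p) < letter w j) == g p]].

Lemma letter_inj w i j :
  i < n.+1 -> j < n.+1 -> (letter w i == letter w j) = (i == j).
Proof.
move=> lti ltj; rewrite /letter (inj_eq val_inj) (inj_eq perm_inj).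
by rewrite -(inj_eq val_inj) /= !inordK.
Qed.

Lemma windowP w a :
  reflect (a + k <= n.+1 /\ forall p q, p < k -> q < k ->
             (letter w (a + p) < letter w (a + q)) = (s p < s q))
          (window w a).
Proof.
apply: (iffP andP) => [[ak /forallP H]|[ak H]]; split=> //.
  move=> p q pk qk.
  have /forallP Hp := H (Ordinal pk).
  by have /eqP := Hp (Ordinal qk).
by apply/forallP => p; apply/forallP => q; apply/eqP/H.
Qed.

Lemma completedP g w a :
  reflect (exists2 j, a + k <= j < n.+1 &
             forall p, p < k -> (letter w (a + p) < letter w j) = g p)
          (completed g w a).
Proof.
apply: (iffP existsP) => [[j /andP[aj /forallP H]]|[j /andP[aj jn] H]].
  exists j; first by rewrite aj ltn_ord.
  by move=> p pk; have /eqP := H (Ordinal pk).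
exists (Ordinal jn); rewrite /= aj; apply/forallP => p.
by apply/eqP/H.
Qed.

(* Only strict lower bounds are compared, so the window letter closing the gap
   from above also satisfies [same_gap]; [gap_values] excludes it by position. *)
Definition same_gap w a (v : nat) : bool :=
  [forall p : 'I_k, (val p != key) ==>
     ((letter w (a + p) < v) == (letter w (a + p) < letter w (a + key)))].

Lemma same_gapP w a v :
  reflect (forall p, p < k -> p != key ->
             (letter w (a + p) < v) = (letter w (a + p) < letter w (a + key)))
          (same_gap w a v).
Proof.
apply: (iffP forallP) => [H p pk pkey|H p].
  by have /implyP/(_ pkey)/eqP := H (Ordinal pk).
by apply/implyP => pkey; apply/eqP/H.
Qed.

Definition gap_values w a : {set 'I_n.+1} :=
  [set v : 'I_n.+1 | (((w^-1)%g v == a + key :> nat) || (a + k <= (w^-1)%g v))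
                     && same_gap w a v].

(** The product acts on values after [w]. Leaving [w] alone when there is no window gives a self-map
    of all permutations. *)
Definition rot_gap w a : 'S_n.+1 :=
  if window w a then (w * rot_values (gap_values w a))%g else w.

Hypothesis key_lt : key < k.
Hypothesis s_inj : forall p, p < k -> s p = s key -> p = key.
(** The form in which the overlap hypothesis is used: the common part of two windows contains
    neither key position. *)
Hypothesis key_isolated : forall w a b,
  window w a -> window w b -> a < b < a + k -> a + key < b /\ a + k <= b + key.

Lemma key_outside w a b : window w a -> window w b -> a != b ->
  b + k <= a + key \/ a + key < b.
Proof.
move=> wa wb; case: (ltngtP a b) => // ltab _.
  case: (ltnP b (a + k)) => [ltb|]; last lia.
  by have [|] := key_isolated wa wb; [lia | right].
case: (ltnP a (b + k)) => [lta|]; last lia.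
by have [|] := key_isolated wb wa; [lia | left].
Qed.

Lemma mem_gap w a j : j < n.+1 ->
  (w (inord j) \in gap_values w a) =
  ((j == a + key) || (a + k <= j)) && same_gap w a (letter w j).
Proof. by move=> jn; rewrite inE permK inordK. Qed.

(** * Effect of the rotation at a single window *)

Section Rotation.

Variables (w : 'S_n.+1) (a : nat).
Hypothesis wa : window w a.
Let S := gap_values w a.
Let w' := (w * rot_values S)%g.

Let ak : a + k <= n.+1. Proof. by case/windowP: wa. Qed.

Let letter'E j : letter w' j = rot_values S (w (inord j)).
Proof. by rewrite /letter permM. Qed.

Let keyS : w (inord (a + key)) \in S.
Proof. rewrite mem_gap ?eqxx; [exact/same_gapP | lia]. Qed.

Lemma rot_letter_out j : j < n.+1 -> j != a + key -> j < a + k ->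
  letter w' j = letter w j.
Proof.
move=> jn nj ltj; rewrite letter'E rot_values_out // mem_gap //.
by rewrite (negbTE nj) leqNgt ltj.
Qed.

Lemma rot_key_gap : same_gap w a (letter w' (a + key)).
Proof.
have : rot_values S (w (inord (a + key))) \in S by rewrite mem_rot_values.
by rewrite letter'E inE => /andP[].
Qed.

(** Only the key letter of the window can change, and it stays in the same gap between the
    others. *)
Lemma rot_window_self : window w' a.
Proof.
apply/windowP; split=> // p q pk qk; have [_ Hw] := windowP _ _ wa.
have out r : r < k -> r != key -> letter w' (a + r) = letter w (a + r).
  by move=> rk nr; rewrite rot_letter_out ?eqn_add2l //; lia.
have gap := same_gapP _ _ _ rot_key_gap.
have nlt v u : v != u -> (v < u) = ~~ (u < v) by lia.
case: (eqVneq p key) => [->|np]; case: (eqVneq q key) => [->|nq].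
- by rewrite !ltnn.
- rewrite nlt ?letter_inj ?eqn_add2l 1?eq_sym //; try lia.
  rewrite out // gap // Hw //.
  rewrite -!Hw // [RHS]nlt ?letter_inj ?eqn_add2l //; try lia.
- by rewrite out // gap // Hw.
- by rewrite !out // Hw.
Qed.

Lemma rot_same_gap v : same_gap w' a v = same_gap w a v.
Proof.
have gap := same_gapP _ _ _ rot_key_gap.
have out r : r < k -> r != key -> letter w' (a + r) = letter w (a + r).
  by move=> rk nr; rewrite rot_letter_out ?eqn_add2l //; lia.
by apply/same_gapP/same_gapP => H p pk np; have := H p pk np;
  rewrite out // gap.
Qed.

(** The gap is delimited by unchanged letters, and the rotation permutes [S] among the positions
    holding it. Hence [S] can be read off the rotated word, which makes the rotation reversible. *)
Lemma rot_gap_values : gap_values w' a = S.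
Proof.
apply/setP => v; rewrite inE rot_same_gap invMg permM.
set u := ((rot_values S)^-1)%g v.
have -> : v = rot_values S u by rewrite permKV.
case: (boolP (u \in S)) => uS; last first.
  by rewrite rot_values_out // (negbTE uS) -[RHS](negbTE uS) inE.
have : rot_values S u \in S by rewrite mem_rot_values.
move=> RS; rewrite RS; move: uS RS; rewrite !inE => /andP[-> _] /andP[_ ->].
by [].
Qed.

(** All of [S] sits at or after the key position, hence right of the cut [m], and is merely
    permuted. A window ending before the key position depends on later letters only through this
    set. *)
Lemma rot_later_values m v : m <= a + key ->
  (exists2 j, m <= j < n.+1 & letter w' j = v) <->
  (exists2 j, m <= j < n.+1 & letter w j = v).
Proof.
move=> lem.
have pos_S u : u \in S -> exists2 j, m <= j < n.+1 & w (inord j) = u.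
  move=> uS; exists ((w^-1)%g u); last by rewrite inord_val permKV.
  by rewrite ltn_ord andbT; move: uS; rewrite inE => /andP[]; lia.
split=> [] [j mj <-].
  rewrite letter'E; case: (boolP (w (inord j) \in S)) => jS.
    have [|j' mj' E] := pos_S (rot_values S (w (inord j))).
      by rewrite mem_rot_values.
    by exists j' => //; rewrite /letter E.
  by exists j; rewrite // rot_values_out.
rewrite /letter; case: (boolP (w (inord j) \in S)) => jS; last first.
  by exists j; rewrite // permM rot_values_out.
have [|j' mj' E] := pos_S (((rot_values S)^-1)%g (w (inord j))).
  by rewrite -mem_rot_values permKV.
by exists j' => //; rewrite permM E permKV.
Qed.

Hypothesis keymax : {in S, forall v : 'I_n.+1, v <= letter w (a + key)}.

(** A window letter compares alike with the whole gap by definition; a letter after the window and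
    outside the gap is cut off from it by some window letter. *)
Lemma gap_separated (x : 'I_n.+1) j :
    x \in S -> a + key < j < n.+1 -> w (inord j) \notin S ->
  (letter w j < x) = (letter w j < letter w (a + key)).
Proof.
rewrite inE => /andP[_ /same_gapP gx] /andP[lej jn].
rewrite mem_gap // negb_and orbC; case: (ltnP j (a + k)) => [ltj _|_].
  have -> : j = a + (j - a) by lia.
  by apply: gx; lia.
rewrite orbT /= orbF => /forallPn[p]; rewrite negb_imply => /andP[np].
have := gx p (ltn_ord p) np.
lia.
Qed.

(** The values of [S] right of the key exclude its maximum, and on those the rotation is increasing.
    Other letters lie on one side of all of [S]. *)
Lemma rot_later_lt i j : a + key < i < n.+1 -> a + key < j < n.+1 ->
  (letter w' i < letter w' j) = (letter w i < letter w j).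
Proof.
move=> ai aj.
have notkey h : a + key < h < n.+1 -> w (inord h) != w (inord (a + key)).
  move=> ah; rewrite -(inj_eq val_inj) -!/(letter _ _) letter_inj; lia.
have [_ mono] := rot_values_max keyS keymax.
have sep h (x y : 'I_n.+1) : a + key < h < n.+1 -> w (inord h) \notin S ->
    x \in S -> y \in S -> (letter w h < x) = (letter w h < y).
  by move=> ah hS xS yS; rewrite (gap_separated xS) // (gap_separated yS).
have nlt v u : v != u -> (v < u) = ~~ (u < v) by lia.
have ltC h (x : 'I_n.+1) : w (inord h) \notin S -> x \in S ->
    (x < letter w h) = ~~ (letter w h < x).
  move=> hS xS; apply: nlt; apply: contraNneq hS => /val_inj <- //.
rewrite !letter'E.
case: (boolP (w (inord i) \in S)) => iS; case: (boolP (w (inord j) \in S)) => jS.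
- by rewrite mono // in_setD1 notkey.
- rewrite (rot_values_out jS) -/(letter w j) (ltC _ _ jS iS) (ltC _ _ jS);
    last by rewrite mem_rot_values.
  by congr (~~ _); apply: sep; rewrite ?mem_rot_values.
- rewrite (rot_values_out iS) -/(letter w i).
  by apply: sep; rewrite ?mem_rot_values.
- by rewrite !rot_values_out.
Qed.


Lemma rot_letter_before j : j < a + key -> letter w' j = letter w j.
Proof. by move=> ltj; apply: rot_letter_out; lia. Qed.

Lemma rot_window_lt b p q : b + k <= n.+1 -> p < k -> q < k ->
    b + k <= a + key \/ a + key < b ->
  (letter w' (b + p) < letter w' (b + q)) = (letter w (b + p) < letter w (b + q)).
Proof.
move=> bk pk qk [ltb|ltb]; last by apply: rot_later_lt; lia.
by rewrite !rot_letter_before //; lia.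
Qed.

(** Any other window lies on one side of the key position: to the left letters are unchanged, to the
    right their order is. *)
Lemma rot_window b : window w' b = window w b.
Proof.
have [<-|nab] := eqVneq a b.
  by apply/idP/idP => _ //; exact: rot_window_self.
apply/idP/idP => wb; have [bk Hb] := windowP _ _ wb; apply/windowP; split=> // p q pk qk.
  by rewrite -rot_window_lt ?Hb //; apply: key_outside wb nab; apply: rot_window_self.
by rewrite rot_window_lt ?Hb //; apply: key_outside wb nab.
Qed.

Lemma rot_completed g b : window w b -> a != b ->
  completed g w' b = completed g w b.
Proof.
move=> wb nab; have [bk _] := windowP _ _ wb.
(* Right of the key the same witness [j] works. Left of it the completing value may have moved, so
   its new position is found by [rot_later_values]. *)
have [ltb|ltb] := key_outside wa wb nab; last first.
  by apply/completedP/completedP => -[j bj H]; exists j => // p pk;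
    rewrite -H // rot_later_lt; lia.
have before p : p < k -> letter w' (b + p) = letter w (b + p).
  by move=> pk; apply: rot_letter_before; lia.
apply/completedP/completedP => -[j bj H].
  have [j' bj' E] : exists2 i, b + k <= i < n.+1 & letter w i = letter w' j.
    by apply/rot_later_values => //; exists j.
  by exists j' => // p pk; rewrite E -before ?H.
have [j' bj' E] : exists2 i, b + k <= i < n.+1 & letter w' i = letter w j.
  by apply/rot_later_values => //; exists j.
by exists j' => // p pk; rewrite E before ?H.
Qed.

End Rotation.

(** * The two completions and the successive rotations *)

Definition above p := s p <= s key.
Definition below p := s p < s key.

Lemma above_other p : p < k -> p != key -> above p = (s p < s key).
Proof.
move=> pk np; rewrite /above leq_eqVlt orb_idl // => /eqP/(s_inj pk) E.
by rewrite E eqxx in np.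
Qed.

Lemma mem_gapP w a (v : 'I_n.+1) : a + k <= n.+1 -> v \in gap_values w a ->
  exists2 j, j < n.+1 & w (inord j) = v /\ ((j == a + key) || (a + k <= j)).
Proof.
move=> ak; rewrite inE => /andP[H _].
by exists ((w^-1)%g v); rewrite ?inord_val ?permKV.
Qed.

(** A completing letter is exactly a later letter of the gap that exceeds the key letter. *)
Lemma not_completed_above w a : window w a ->
  ~~ completed above w a <->
  {in gap_values w a, forall v : 'I_n.+1, v <= letter w (a + key)}.
Proof.
move=> wa; have [ak Hw] := windowP _ _ wa; split.
  move=> /completedP nc v vS; rewrite leqNgt; apply/negP => ltv; case: nc.
  have [j jn [jv /orP[/eqP ja|aj]]] := mem_gapP ak vS.
    by move: ltv; rewrite -jv ja ltnn.
  exists j; first by rewrite aj.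
  move: vS; rewrite inE /letter jv => /andP[_ /same_gapP gap] p pk.
  have [->|np] := eqVneq p key; first by rewrite /above leqnn.
  by rewrite gap // Hw // above_other.
move=> maxk; apply/completedP => -[j /andP[aj jn] H].
have jS : w (inord j) \in gap_values w a.
  rewrite mem_gap // aj orbT; apply/same_gapP => p pk np.
  by rewrite H // Hw // above_other.
by have := maxk _ jS; rewrite leqNgt -/(letter w j) H // /above leqnn.
Qed.

Lemma not_completed_below w a : window w a ->
  ~~ completed below w a <->
  {in gap_values w a, forall v : 'I_n.+1, letter w (a + key) <= v}.
Proof.
move=> wa; have [ak Hw] := windowP _ _ wa; split.
  move=> /completedP nc v vS; rewrite leqNgt; apply/negP => ltv; case: nc.
  have [j jn [jv /orP[/eqP ja|aj]]] := mem_gapP ak vS.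
    by move: ltv; rewrite -jv ja ltnn.
  exists j; first by rewrite aj.
  move: vS; rewrite inE /letter jv => /andP[_ /same_gapP gap] p pk.
  have [->|np] := eqVneq p key; last by rewrite gap // Hw.
  by rewrite /below ltnn ltnNge ltnW.
move=> mink; apply/completedP => -[j /andP[aj jn] H].
have jS : w (inord j) \in gap_values w a.
  by rewrite mem_gap // aj orbT; apply/same_gapP => p pk np; rewrite H // Hw.
have := mink _ jS; rewrite -/(letter w j) leq_eqVlt H // /below ltnn orbF.
by rewrite letter_inj; lia.
Qed.

(** The image reveals whether there was a window at [a] and which set was rotated. *)
Lemma rot_gap_inj a : injective (rot_gap^~ a).
Proof.
move=> u v; rewrite /rot_gap; case: ifP => wu; case: ifP => wv E //.
- have := rot_gap_values wu; rewrite E (rot_gap_values wv) => gE.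
  by move: E; rewrite gE => /mulIg.
- by rewrite -E rot_window_self in wv.
- by rewrite E rot_window_self in wu.
Qed.

(* The windows starting before [m] have already been rotated. *)
Definition hybrid m : {set 'S_n.+1} :=
  [set w | [forall a : 'I_n.+1, window w a ==>
              ~~ completed (if a < m then below else above) w a]].

Lemma hybridP m w :
  reflect (forall a, window w a ->
             ~~ completed (if a < m then below else above) w a)
          (w \in hybrid m).
Proof.
rewrite inE; apply: (iffP forallP) => [H a wa|H a].
  have an : a < n.+1 by case/windowP: wa; lia.
  by have /implyP/(_ wa) := H (Ordinal an).
by apply/implyP/H.
Qed.

Lemma rot_hybrid m w : (rot_gap w m \in hybrid m.+1) = (w \in hybrid m).
Proof.
have other a : a != m -> (a < m.+1) = (a < m) by lia.
rewrite /rot_gap; case: ifP => [wm|nwm]; last first.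
  by apply/hybridP/hybridP => H a wa; have := H a wa;
    rewrite other //; apply: contraFneq nwm => <-.
have mk : m + k <= n.+1 by case/windowP: wm.
set S := gap_values w m; set w' := (w * _)%g.
pose x := w (inord (m + key)).
have xS : x \in S by rewrite mem_gap ?eqxx; [exact/same_gapP | lia].
have w'm : window w' m := rot_window_self wm.
have gapS : gap_values w' m = S := rot_gap_values wm.
have w'x : letter w' (m + key) = rot_values S x by rewrite /letter permM.
apply/hybridP/hybridP => H.
  (* The key letter [x] must first be shown maximal. The maximum [y] rotates to the minimum of [S],
     and so does [x] by assumption; injectivity gives [x = y]. *)
  have [y yS ymax] := @arg_maxnP _ x (mem S) (@nat_of_ord n.+1) xS.
  have [miny _] := rot_values_max yS ymax.
  have minx : {in S, forall v : 'I_n.+1, rot_values S x <= v}.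
    have := H m w'm; rewrite ltnS leqnn => /(not_completed_below w'm).
    by rewrite gapS w'x.
  have xy : x = y.
    apply/(@perm_inj _ (rot_values S))/val_inj/eqP; rewrite eqn_leq.
    by rewrite minx ?miny ?mem_rot_values.
  have xmax : {in S, forall v : 'I_n.+1, v <= letter w (m + key)}.
    by rewrite /letter -/x xy; apply: ymax.
  move=> a wa; have [->|nam] := eqVneq a m.
    by rewrite ltnn; apply/(not_completed_above wm).
  rewrite -other // -(rot_completed wm xmax) // 1?eq_sym //.
  by apply: H; rewrite rot_window.
have xmax : {in S, forall v : 'I_n.+1, v <= letter w (m + key)}.
  by apply/(not_completed_above wm); have := H m wm; rewrite ltnn.
move=> a w'a; have [->|nam] := eqVneq a m.
  rewrite ltnSn; apply/(not_completed_below w'm); rewrite gapS w'x.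
  exact: (rot_values_max xS xmax).1.
have wa : window w a by rewrite -(rot_window wm xmax).
by rewrite other // (rot_completed wm xmax) // 1?eq_sym // H.
Qed.

Lemma card_hybrid m : #|hybrid m| = #|hybrid 0|.
Proof.
elim: m => // m <-; rewrite -(card_preimset _ (@rot_gap_inj m)).
by apply: eq_card => w; rewrite inE rot_hybrid.
Qed.

Lemma card_uncompleted :
  #|[set w | [forall a : 'I_n.+1, window w a ==> ~~ completed below w a]]| =
  #|[set w | [forall a : 'I_n.+1, window w a ==> ~~ completed above w a]]|.
Proof.
have := card_hybrid n.+1; rewrite /hybrid => E.
rewrite -[RHS]E; apply: eq_card => w; rewrite !inE.
by apply: eq_forallb => a; rewrite ltn_ord.
Qed.

End Windows.

(** * Pattern occurrences as completed windows *)

Lemma order_isoP (u v : seq nat) :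
  reflect (size u = size v /\ forall p q, p < size u -> q < size u ->
             (nth 0 u p < nth 0 u q) = (nth 0 v p < nth 0 v q))
          (order_iso u v).
Proof.
apply: (iffP andP) => [[/eqP-> /forallP H]|[E H]]; split=> //.
- move=> p q pk qk; have /forallP Hp := H (Ordinal pk).
  by have /eqP := Hp (Ordinal qk).
- exact/eqP.
by apply/forallP => p; apply/forallP => q; apply/eqP/H.
Qed.

Lemma size_letters k (T : 'I_k.+1 -> nat) :
  size [seq T j | j <- enum 'I_k.+1] = k.+1.
Proof. by rewrite size_map size_enum_ord. Qed.

Lemma nth_letters k (T : 'I_k.+1 -> nat) p : p < k.+1 ->
  nth 0 [seq T j | j <- enum 'I_k.+1] p = T (inord p).
Proof.
move=> pk; rewrite (nth_map ord0) ?size_enum_ord //; congr T.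
by apply: val_inj; rewrite /= nth_enum_ord // inordK.
Qed.

Lemma qc_containsP k n (sigma : 'S_k.+1) (w : 'S_n.+1) : 0 < k ->
  reflect (exists2 a, window k (letter sigma) w a &
             completed k (fun p => letter sigma p < letter sigma k) w a)
          (qc_contains sigma w).
Proof.
move=> k_gt0; apply: (iffP existsP) =>
  [[f /and3P[/forallP incf /forallP adjf /order_isoP[]]]|].
  rewrite /one_line !size_letters => _ iso.
  have {}iso p q : p < k.+1 -> q < k.+1 ->
      (w (f (inord p)) < w (f (inord q))) = (letter sigma p < letter sigma q).
    by move=> pk qk; have := iso p q pk qk; rewrite !nth_letters.
  have fE p : p < k -> f (inord p) = f ord0 + p :> nat.
    elim: p => [|p IHp] pk.
      by rewrite addn0; congr (nat_of_ord (f _)); apply: val_inj; rewrite /= inordK.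
    have /forallP/(_ (inord p.+1))/implyP := adjf (inord p).
    rewrite /= !inordK ?eqxx ?pk; try lia.
    by move=> /(_ isT)/eqP ->; rewrite IHp ?addnS //; lia.
  have flast : f ord0 + k <= f (inord k).
    have /forallP/(_ (inord k)) := incf (inord k.-1).
    have k1k : k.-1 < k by lia.
    by rewrite !inordK ?(fE k.-1 k1k) ?k1k //=; lia.
  have fn := ltn_ord (f (inord k)).
  have letE p : p < k -> letter w (f ord0 + p) = w (f (inord p)).
    by move=> pk; rewrite -fE // /letter inord_val.
  exists (f ord0 : nat).
    apply/windowP; split=> [|p q pk qk]; first lia.
    by rewrite !letE // iso //; lia.
  apply/completedP; exists (f (inord k) : nat); first by rewrite flast.
  by move=> p pk; rewrite letE // /letter inord_val iso //; lia.
move=> [a /windowP[ak Hw] /completedP[j /andP[aj jn] Hj]].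
(* An occurrence is recovered from the start [a] of its window and the position [j] of its last
   letter. *)
pose place p := if p < k then a + p else j.
have place_lt p : place p < n.+1 by rewrite /place; case: ifP => ?; lia.
exists [ffun p : 'I_k.+1 => inord (place p)]; apply/and3P; split.
- apply/forallP => p; apply/forallP => q; apply/implyP => pq.
  rewrite !ffunE !inordK // /place; have := ltn_ord q; have := ltn_ord p.
  case: ifP => ?; case: ifP => ?; lia.
- apply/forallP => p; apply/forallP => q; apply/implyP => /andP[/eqP E qk].
  rewrite !ffunE /= !inordK // /place; move: E qk => /= -> qk.
  by rewrite qk ifT ?addnS //; lia.
apply/order_isoP; rewrite /one_line !size_letters; split=> // p q pk qk.
rewrite !nth_letters // !ffunE !inordK // !ltnS -!/(letter _ _).
have leq_case r : r < k.+1 -> r < k \/ r = k by lia.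
have nlt u v : u != v -> (v < u) = ~~ (u < v) by lia.
rewrite /place; case: (leq_case p pk) => [pk'|->]; case: (leq_case q qk) => [qk'|->];
  rewrite ?ltnn ?pk' ?qk' ?Hw ?Hj //.
rewrite nlt ?[RHS]nlt ?Hj // letter_inj; lia.
Qed.

(** * Application to the two patterns *)

Theorem theorem4p7 (k : nat) (sigma : 'S_k.+1) (i : nat)
  (hk : 3 <= k)
  (hi : 2 <= i <= k - 1)
  (hsigma : val (sigma (pos k k.+1)) = (sigma (pos k i)).+1)
  (hoverlap : forall z : nat, minn i (k - i + 1) <= z < k ->
     ~~ order_iso (factor (one_line sigma) 1 z)
                  (factor (one_line sigma) (k - z + 1) k)) :
  wilf_equiv sigma (swap_letters (pos k i) (pos k k.+1) sigma).
Proof.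
case=> // n _; set tau := swap_letters _ _ _.
(* [key] is the 0-based offset of the distinguished position [i]. *)
pose key := i.-1; pose s := letter sigma.
have key_lt : key < k by rewrite /key; lia.
have s_last : s k = (s key).+1 by exact: hsigma.
have s_inj p q : p < k.+1 -> q < k.+1 -> (s p == s q) = (p == q).
  by move=> pk qk; apply: letter_inj.
have tauE p : p < k.+1 ->
    letter tau p = if p == key then s k else if p == k then s key else s p.
  move=> pk; rewrite /letter permM /pos -/key /=.
  case: tpermP => [|| /eqP nkey /eqP nk].
  - move=> /(congr1 val); rewrite /= !inordK; try lia.
    by move=> ->; rewrite eqxx.
  - move=> /(congr1 val); rewrite /= !inordK; try lia.
    by move=> ->; rewrite eqxx gtn_eqF.
  by move: nkey nk; rewrite -!(inj_eq val_inj) /= !inordK; try lia;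
    move=> /negbTE-> /negbTE->.
have tau_last : letter tau k = s key by rewrite tauE // gtn_eqF ?eqxx.
have tau_lt p : p < k -> letter tau p = if p == key then (s key).+1 else s p.
  by move=> pk; rewrite tauE ?s_last ?(ltn_eqF pk) //; lia.
have lt_keyS p : p < k -> p != key -> (s p < (s key).+1) = (s p < s key).
  by move=> pk np; have := s_inj p key; lia.
have keyS_lt p : p < k -> ((s key).+1 < s p) = (s key < s p).
  by move=> pk; have := s_inj p k; lia.
(* The value [(s key).+1] belongs to the last letter of [sigma], so raising the key letter to it
   changes no comparison among the first [k] letters. *)
have windowE (w : 'S_n.+1) a : window k (letter tau) w a = window k s w a.
  have E p q : p < k -> q < k -> (letter tau p < letter tau q) = (s p < s q).
    move=> pk qk; rewrite !tau_lt //.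
    have [->|np] := eqVneq p key; have [->|nq] := eqVneq q key; rewrite ?ltnn //.
    - exact: keyS_lt.
    - exact: lt_keyS.
  by apply/windowP/windowP => -[ak H]; split=> // p q pk qk; rewrite H ?E.
have isolated (w : 'S_n.+1) a b : window k s w a -> window k s w b ->
    a < b < a + k -> a + key < b /\ a + k <= b + key.
  move=> /windowP[ak Ha] /windowP[bk Hb] ab.
  (* The overlap length. The shared letters are a suffix of the window at [a] and a prefix of the
     one at [b], so [hoverlap] forces [z] below both [i] and [k - i + 1]. *)
  pose z := a + k - b.
  have : ~~ (minn i (k - i + 1) <= z < k).
    apply/negP => Hz; have := hoverlap z Hz; apply/negP/negPn.
    have sz : size (one_line sigma) = k.+1 by rewrite size_map size_enum_ord.
    apply/order_isoP; rewrite /factor drop0 size_drop !size_take sz.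
    rewrite !ifT; try lia.
    split=> [|p q pz qz]; first lia.
    rewrite !nth_drop !nth_take; try lia.
    rewrite !nth_letters; try lia.
    rewrite !ltnS -!/(letter _ _) -/s -Hb -?Ha; try lia.
    by congr (letter w _ < letter w _); lia.
  lia.
have avoidE (pat : 'S_k.+1) g :
    (forall p, p < k -> (letter pat p < letter pat k) = g p) ->
    (forall (w : 'S_n.+1) a, window k (letter pat) w a = window k s w a) ->
  #|qc_avoiders n.+1 pat| =
  #|[set w : 'S_n.+1 | [forall a : 'I_n.+1,
      window k s w a ==> ~~ completed k g w a]]|.
  move=> gE wE; apply: eq_card => w; rewrite !inE.
  have cE a : completed k (fun p => letter pat p < letter pat k) w a = completed k g w a.
    by apply/completedP/completedP => -[j aj H]; exists j => // p pk;
      rewrite H ?gE.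
  apply/idP/forallP => [nc a|H].
    apply/implyP => wa; apply: contra nc => ca; apply/qc_containsP; first lia.
    by exists (val a); rewrite ?wE ?cE.
  apply/negP => /qc_containsP[|a wa ca]; first lia.
  have an : a < n.+1 by case/windowP: wa; lia.
  by have := H (Ordinal an); rewrite /= -cE ca -wE wa.
rewrite (avoidE sigma (above s key)); first last.
- by [].
- by move=> p pk; rewrite -/s s_last ltnS.
rewrite (avoidE tau (below s key)); first last.
- exact: windowE.
(* At the key position [tau] has [(s key).+1], not below its last letter [s key], as [below]
   requires. *)
- move=> p pk; rewrite tau_last tau_lt // /below.
  by case: eqP => [->|//]; rewrite ltnn; lia.
symmetry; apply: card_uncompleted => //.
by move=> p pk /eqP; rewrite s_inj => [/eqP||]; lia.
Qed.
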